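(* Let $G$ be a finite, indecomposable, nonabelian $2$-group, and suppose there exists $a\in G$ with $|a|\geq 8$ and $C_G(a)=\langle a\rangle$. Then there is no finite ring $R$ with $R^\times\cong G$.
   Context: All rings are associative and unital; $R^\times$ denotes the group of units of the ring $R$. A group is indecomposable if it is not isomorphic to a direct product of two nontrivial groups. $|a|$ is the order of $a$ and $C_G(a)$ its centralizer in $G$. *)

(* Defs.v *)
From HB Require Import structures.
From mathcomp Require Import all_boot all_order all_fingroup all_algebra all_solvable.

Set Implicit Arguments.
Unset Strict Implicit.
Unset Printing Implicit Defensive.

Local Open Scope group_scope.

(* The ambient types hT and kT are unrelated to gT, so this is the external
   direct product; finite factors suffice because G is finite. The trivial group
   counts as indecomposable. *)
Definition indecomposable (gT : finGroupType) (G : {set gT}) : Prop :=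
  ~ exists (hT kT : finGroupType) (H : {group hT}) (K : {group kT}),
      [/\ H :!=: 1, K :!=: 1 & G \isog setX H K].

(* [set: {unit R}] is the group of two-sided units of a finUnitRingType R. Every
   nonzero finite ring is a finUnitRingType: units and inverses are computed by
   exhaustive search in FinRing.isNzRing. The unit group of the zero ring is
   trivial, so the zero ring never realizes a nontrivial group. *)
Definition finite_ring_realizable (gT : finGroupType) (G : {set gT}) : Prop :=
  exists R : finUnitRingType, [set: {unit R}] \isog G.

(* Main.v *)
Require Import Defs.
From HB Require Import structures.
From mathcomp Require Import all_boot all_order all_fingroup all_algebra all_solvable.
From mathcomp Require Import finfield.

(* Some positive power e of 2 in R is a central idempotent, which splits R^* as
   the direct product of the unit groups of eR and (1 - e)R; by
   indecomposability one factor is trivial. If R^* lives on eR, where 2 is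
   invertible, a square-zero x gives a unit 1 + x whose order is a power of 2,
   so x = 0: eR is reduced, hence a product of finite division rings, hence
   commutative by Wedderburn, and R^* is abelian.
   Otherwise 2 is nilpotent in R. As the centralizer of a is a cyclic 2-group,
   the only square roots of 1 commuting with x = a - 1, other than 1, coincide.
   Comparing -1 with 1 + 2^j, then with 1 + 2x, gives 4 = 0 and 2x = 0. Then
   a^4 = 1 + x^4 is not 1, so the nilpotency index n of x is at least 5, and
   1 + x^(n-1) and 1 + x^(n-2) are two distinct such roots. *)

Set Implicit Arguments.
Unset Strict Implicit.
Unset Printing Implicit Defensive.

Import GRing.Theory.
Local Open Scope ring_scope.

(** * Idempotent powers in a finite ring *)

Section PowerIdempotent.
Variable R : finUnitRingType.

(** By pigeonhole two powers of [x] coincide, so from some exponent [i] on the powers are periodic;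
    an exponent at least [i] that is a multiple of the period [p] does not change under doubling. *)
Lemma exists_idempotent_expr (x : R) :
  exists2 n, (0 < n)%N & x ^+ n * x ^+ n = x ^+ n.
Proof.
have /injectivePn[i [j neq_ij eq_ij]] :
    ~~ injectiveb (fun i : 'I_#|R|.+1 => x ^+ i).
  by apply: contraL (leqnn #|R|) => /injectiveP/leq_card; rewrite card_ord ltnNge.
wlog lt_ij : i j neq_ij eq_ij / (i < j)%N.
  move=> wl; case: (ltngtP i j) => [|lt_ji|/val_inj eq_val]; first exact: wl.
    by apply: (wl j i); rewrite // eq_sym.
  by rewrite eq_val eqxx in neq_ij.
have [p p_gt0 defj] : exists2 p, (0 < p)%N & val j = (i + p)%N.
  by exists (j - i)%N; rewrite ?subn_gt0 ?subnKC // ltnW.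
have step k : (i <= k)%N -> x ^+ (k + p) = x ^+ k.
  by move=> le_ik; rewrite -(subnK le_ik) -addnA -defj !exprD eq_ij.
have period t k : (i <= k)%N -> x ^+ (k + p * t) = x ^+ k.
  move=> le_ik; elim: t => [|t IHt]; first by rewrite muln0 addn0.
  by rewrite mulnSr addnA step // (leq_trans le_ik) // leq_addr.
(* The factor [i.+1] rather than [i] keeps the exponent positive when [i = 0]. *)
exists (p * i.+1)%N; first by rewrite muln_gt0 p_gt0.
by rewrite -exprD period // (leq_trans (leqnSn i)) // leq_pmull.
Qed.

End PowerIdempotent.

(** * Central idempotents and corner rings *)

Record central_idempotent (R : nzRingType) (e : R) : Prop := CentralIdempotent {
  central_idempotent_idem : e * e = e;
  central_idempotent_comm : forall x, e * x = x * e }.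

Lemma central_idempotent_compl (R : nzRingType) (e : R) :
  central_idempotent e -> central_idempotent (1 - e).
Proof.
case=> ee ec; split=> [|x]; last by rewrite mulrBl mulrBr ec mul1r mulr1.
by rewrite mulrBl mul1r mulrBr mulr1 ee subrr subr0.
Qed.

Definition in_corner (R : nzRingType) (e : R) : pred R := fun x => e * x == x.

(* The unused proofs are parameters so that the ring instance on the type can be
   inferred from it. *)
Definition corner (R : nzRingType) (e : R) (ce : central_idempotent e)
  (e_neq0 : e != 0) : Type := {x : R | in_corner e x}.

Section CornerRing.
Variables (R : finUnitRingType) (e : R).
Hypotheses (ce : central_idempotent e) (e_neq0 : e != 0).
Local Notation eR := (corner ce e_neq0).

HB.instance Definition _ := SubFinite.copy eR {x : R | in_corner e x}.

Lemma corner_mulid (u : eR) : e * val u = val u.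
Proof. exact/eqP/(valP u). Qed.

Let zeroP : in_corner e 0. Proof. by rewrite /in_corner mulr0. Qed.
Let oneP : in_corner e e.
Proof. by rewrite /in_corner central_idempotent_idem. Qed.
Let oppP (u : eR) : in_corner e (- val u).
Proof. by rewrite /in_corner mulrN corner_mulid. Qed.
Let addP (u v : eR) : in_corner e (val u + val v).
Proof. by rewrite /in_corner mulrDr !corner_mulid. Qed.
Let mulP (u v : eR) : in_corner e (val u * val v).
Proof. by rewrite /in_corner mulrA corner_mulid. Qed.

Definition corner_zero : eR := Sub 0 zeroP.
Definition corner_one : eR := Sub e oneP.
Definition corner_opp (u : eR) : eR := Sub (- val u) (oppP u).
Definition corner_add (u v : eR) : eR := Sub (val u + val v) (addP u v).
Definition corner_mul (u v : eR) : eR := Sub (val u * val v) (mulP u v).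

Fact corner_addA : associative corner_add.
Proof. by move=> u v w; apply: val_inj; rewrite /= addrA. Qed.
Fact corner_addC : commutative corner_add.
Proof. by move=> u v; apply: val_inj; rewrite /= addrC. Qed.
Fact corner_add0 : left_id corner_zero corner_add.
Proof. by move=> u; apply: val_inj; rewrite /= add0r. Qed.
Fact corner_addN : left_inverse corner_zero corner_opp corner_add.
Proof. by move=> u; apply: val_inj; rewrite /= addNr. Qed.
Fact corner_mulA : associative corner_mul.
Proof. by move=> u v w; apply: val_inj; rewrite /= mulrA. Qed.
Fact corner_mul1 : left_id corner_one corner_mul.
Proof. by move=> u; apply: val_inj; rewrite /= corner_mulid. Qed.
Fact corner_mulr1 : right_id corner_one corner_mul.
Proof.
by move=> u; apply: val_inj; rewrite /= -central_idempotent_comm ?corner_mulid.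
Qed.
Fact corner_mulDl : left_distributive corner_mul corner_add.
Proof. by move=> u v w; apply: val_inj; rewrite /= mulrDl. Qed.
Fact corner_mulDr : right_distributive corner_mul corner_add.
Proof. by move=> u v w; apply: val_inj; rewrite /= mulrDr. Qed.
Fact corner_one_neq0 : corner_one != corner_zero.
Proof. by rewrite -val_eqE. Qed.

HB.instance Definition _ := GRing.isNzRing.Build eR corner_addA corner_addC
  corner_add0 corner_addN corner_mulA corner_mul1 corner_mulr1
  corner_mulDl corner_mulDr corner_one_neq0.
HB.instance Definition _ := FinRing.isNzRing.Build eR.

Lemma commutative_corner :
    (forall u v : eR, u * v = v * u) ->
  forall x y : R, e * x * (e * y) = e * y * (e * x).
Proof.
move=> eRC x y.
have inP z : in_corner e (e * z).
  by rewrite /in_corner mulrA central_idempotent_idem.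
by have /(congr1 val) := eRC (Sub (e * x) (inP x)) (Sub (e * y) (inP y)).
Qed.

Lemma card_corner : e != 1 -> (#|{: eR}| < #|R|)%N.
Proof.
move=> e_neq1; rewrite card_sub; apply: proper_card.
by apply/properP; split; [exact/subsetP | exists 1; rewrite // inE /= /in_corner mulr1].
Qed.

End CornerRing.

(** * Finite reduced rings *)

Lemma reduced_expr_eq0 (R : nzRingType) (x : R) n :
  (forall y : R, y * y = 0 -> y = 0) -> x ^+ n = 0 -> x = 0.
Proof.
move=> red xn0.
(* With a power of two as exponent, reducedness undoes one squaring at a time. *)
have : x ^+ (2 ^ n) = 0.
  by rewrite -(subnK (ltnW (ltn_expl n (ltnSn 1)))) exprD xn0 mulr0.
elim: {xn0}n => [|n IHn] //; rewrite expnSr exprM expr2 => /red; exact: IHn.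
Qed.

(** Both [e * x * (1 - e)] and [(1 - e) * x * e] square to zero, hence vanish, so [e * x] and
    [x * e] equal [e * x * e]. *)
Lemma reduced_idempotent_central (R : nzRingType) (e : R) :
    (forall y : R, y * y = 0 -> y = 0) -> e * e = e ->
  central_idempotent e.
Proof.
move=> red ee; split=> // x.
have e1e : e * (1 - e) = 0 by rewrite mulrBr mulr1 ee subrr.
have ee1 : (1 - e) * e = 0 by rewrite mulrBl mul1r ee subrr.
have /red : e * x * (1 - e) * (e * x * (1 - e)) = 0.
  by rewrite -!mulrA (mulrA (1 - e) e) ee1 mul0r !mulr0.
have /red : (1 - e) * x * e * ((1 - e) * x * e) = 0.
  by rewrite -!mulrA (mulrA e (1 - e)) e1e mul0r !mulr0.
rewrite mulrBr mulr1 !mulrBl mul1r => /eqP; rewrite subr_eq0 => /eqP->.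
by move/eqP; rewrite subr_eq0 => /eqP.
Qed.

(** Induction on the cardinal: an idempotent other than 0 and 1 is central and splits [R] into two
    smaller reduced corners. If there is none, [R] is a finite domain and Wedderburn's little
    theorem applies. *)
Theorem reduced_finRing_commutative (R : finUnitRingType) :
  (forall x : R, x * x = 0 -> x = 0) -> forall x y : R, x * y = y * x.
Proof.
have [n] := ubnP #|R|; elim: n R => // n IHn R ltRn red x y.
have [/existsP[e /and3P[/eqP ee e_neq0 e_neq1]]|] :=
    boolP [exists e : R, [&& e * e == e, e != 0 & e != 1]].
  have ce := reduced_idempotent_central red ee.
  have cf := central_idempotent_compl ce.
  have f_neq0 : 1 - e != 0 by rewrite subr_eq0 eq_sym.
  have f_neq1 : 1 - e != 1 by rewrite -subr_eq0 addrAC subrr sub0r oppr_eq0.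
  have cornerC (f : R) (cfi : central_idempotent f) (f0 : f != 0) :
      f != 1 -> f * (x * y) = f * (y * x).
    move=> f1; have fM u v : f * u * (f * v) = f * (u * v).
      case: cfi => ff fC.
      by rewrite -mulrA (mulrA u) -fC -!mulrA (mulrA f f) ff.
    rewrite -!fM; apply: (commutative_corner (ce := cfi) (e_neq0 := f0)).
    apply: IHn => [|u uu0].
      exact: leq_trans (card_corner _ _ f1) ltRn.
    exact/val_inj/red/(congr1 val uu0).
  have := congr2 +%R (cornerC e ce e_neq0 e_neq1) (cornerC _ cf f_neq0 f_neq1).
  by rewrite -!mulrDl addrC subrK !mul1r.
rewrite negb_exists => /forallP noid; apply: finDomain_mulrC => u v uv0.
have [m m_gt0 um] := exists_idempotent_expr u.
(* The idempotent [u ^+ m] is 0 or 1. If 0, then [u = 0]; if 1, then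
   [v = u ^+ m.-1 * (u * v) = 0]. *)
move: (noid (u ^+ m)); rewrite um eqxx /= negb_and !negbK.
case/orP=> /eqP um_eq; first by rewrite (reduced_expr_eq0 red um_eq) eqxx.
by rewrite orbC -[v]mul1r -um_eq -(prednK m_gt0) exprSr -mulrA uv0 mulr0 eqxx.
Qed.

(** * Decomposition of the unit group along a central idempotent *)

Section UnitDecomposition.
Variables (R : finUnitRingType).

(* For a central idempotent g, these are the units whose component in gR is
   trivial: a copy of the unit group of (1 - g)R. *)
Definition unit_fixing (g : R) : {set {unit R}} :=
  [set u | g * val u == g].

Lemma unit_fixingP (g : R) (u : {unit R}) :
  reflect (g * val u = g) (u \in unit_fixing g).
Proof. by rewrite inE; apply: eqP. Qed.

Lemma unit_fixing_group_set (g : R) : group_set (unit_fixing g).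
Proof.
apply/group_setP; split=> [|u v /unit_fixingP gu /unit_fixingP gv].
  by apply/unit_fixingP; rewrite mulr1.
by apply/unit_fixingP; rewrite FinRing.val_unitM mulrA gu gv.
Qed.

Canonical unit_fixing_group g := Group (unit_fixing_group_set g).

(* The projection of u onto the unit group of eR. *)
Lemma peirce_unit (e : R) (ce : central_idempotent e) (u : {unit R}) :
  e * val u + (1 - e) \is a GRing.unit.
Proof.
(* The projection is multiplicative, so the image of the inverse inverts the image. *)
have peirceM x y : (e * x + (1 - e)) * (e * y + (1 - e)) = e * (x * y) + (1 - e).
  case: ce => ee ec; have e1e : e * (1 - e) = 0 by rewrite mulrBr mulr1 ee subrr.
  have ee1 : (1 - e) * e = 0 by rewrite mulrBl mul1r ee subrr.
  have exey : e * x * (e * y) = e * (x * y).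
    by rewrite -mulrA (mulrA x) -(ec x) -mulrA mulrA ee.
  have ff : (1 - e) * (1 - e) = 1 - e by rewrite mulrBl mul1r e1e subr0.
  move: (1 - e) e1e ee1 ff => f ef fe ff.
  have exf : e * x * f = 0 by rewrite (ec x) -mulrA ef mulr0.
  by rewrite mulrDl !mulrDr exey exf (mulrA f e) fe mul0r addr0 add0r ff.
apply/unitrP; exists (e * (val u)^-1 + (1 - e)).
by rewrite !peirceM mulVr ?mulrV ?(valP u) // mulr1 addrC subrK.
Qed.

(** A unit is determined by its components in [e R] and [(1 - e) R], and [u] is the product of its
    projections [p] and [q] onto the two unit groups. *)
Lemma unit_dprod (e : R) :
    central_idempotent e ->
  (unit_fixing (1 - e) \x unit_fixing e)%g = [set: {unit R}].
Proof.
move=> ce; have cf := central_idempotent_compl ce.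
have memK g h (u v : {unit R}) : g + h = 1 -> g * val u = g * val v ->
    h * val u = h * val v -> u = v.
  by move=> gh1 gu hu; apply/val_inj; rewrite -[LHS]mul1r -[RHS]mul1r -gh1
    !mulrDl gu hu.
have ef1 : e + (1 - e) = 1 by rewrite addrC subrK.
have [ee ec] := ce; have [ff fc] := cf.
have fe0 : (1 - e) * e = 0 by rewrite mulrBl mul1r ee subrr.
have ef0 : e * (1 - e) = 0 by rewrite mulrBr mulr1 ee subrr.
rewrite dprodE; first last.
- apply/trivgP/subsetP=> u; rewrite inE => /andP[].
  move=> /unit_fixingP fu /unit_fixingP eu.
  by apply/set1P/(memK _ _ _ _ ef1); rewrite ?eu ?fu mulr1.
- apply/centsP=> v /unit_fixingP ev u /unit_fixingP fu.
  apply: (memK _ _ _ _ ef1); rewrite !FinRing.val_unitM !mulrA.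
    by rewrite ev ec -mulrA ev -ec.
  by rewrite fu fc -mulrA fu -fc.
apply/setP=> u; rewrite !inE; apply/mulsgP.
set p := FinRing.Unit (peirce_unit ce u).
set q := FinRing.Unit (peirce_unit cf u).
have [ep fp] : e * val p = e * val u /\ (1 - e) * val p = 1 - e.
  by rewrite /= !(mulrDr _ (_ * _)) !mulrA ee ef0 fe0 mul0r ff addr0 add0r.
have [eq fq] : e * val q = e /\ (1 - e) * val q = (1 - e) * val u.
  by rewrite /= subKr !(mulrDr _ (_ * _)) !mulrA ee ef0 fe0 mul0r ff addr0 add0r.
exists p q; [exact/unit_fixingP | exact/unit_fixingP |].
apply: (memK _ _ _ _ ef1); rewrite FinRing.val_unitM mulrA.
  by rewrite ep ec -mulrA eq.
by rewrite fp fq.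
Qed.

End UnitDecomposition.

Lemma indecomposable_dprod (gT : finGroupType) (G H K : {group gT}) :
  indecomposable G -> (H \x K)%g = G -> (H :=: 1 \/ K :=: 1)%g.
Proof.
move=> indG defG; have [-> | H1] := eqVneq (H : {set gT}) 1%g; first by left.
have [-> | K1] := eqVneq (K : {set gT}) 1%g; first by right.
case: indG; exists gT, gT, H, K; split=> //.
by rewrite isog_sym (misom_isog (introT mulgmP defG)).
Qed.

(** * Units supported on the corner where 2 is invertible *)

Lemma expr1D_sqr0 (R : nzRingType) (x : R) n :
  x * x = 0 -> (1 + x) ^+ n = 1 + x *+ n.
Proof.
move=> xx0; elim: n => [|n IHn]; first by rewrite addr0.
by rewrite exprSr IHn mulrDr mulr1 mulrDl mul1r mulrnAl xx0 mul0rn addr0 mulrSr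
  addrA.
Qed.

Lemma abelian_units_two_invertible (R : finUnitRingType) (n : nat) :
    (2.-group [set: {unit R}])%g -> (0 < n)%N -> central_idempotent (2 ^+ n : R) ->
    unit_fixing (2 ^+ n : R) = 1%g ->
  abelian [set: {unit R}].
Proof.
set e := 2 ^+ n => G2 n_gt0 ce Ke1; have [ee ec] := ce.
have fU (u : {unit R}) : (1 - e) * val u = 1 - e.
  have := unit_dprod ce; rewrite Ke1 dprodg1 => defG.
  by apply/unit_fixingP; rewrite defG inE.
(* The order of [1 + x] divides some [2 ^ k], so [x *+ 2 ^ k = 0]; but [x = e ^+ k * x], and
   [e ^+ k] is a multiple of [2 ^ k]. *)
have red (x : R) : e * x = x -> x * x = 0 -> x = 0.
  move=> ex xx0; have Ux : 1 + x \is a GRing.unit.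
    apply/unitrP; exists (1 - x).
    rewrite mulrBl mul1r mulrDr mulr1 xx0 addr0 addrK.
    by rewrite mulrBr mulr1 mulrDl mul1r xx0 addr0 addrK.
  have [k cardG] := p_natP G2.
  have /(congr1 val) : (FinRing.Unit Ux ^+ #|[set: {unit R}]| = 1)%g.
    by rewrite expg_cardG // inE.
  rewrite FinRing.val_unitX cardG /= expr1D_sqr0 // => /eqP.
  rewrite -subr_eq0 addrAC subrr add0r => /eqP x2k.
  have {}ex j : e ^+ j * x = x.
    by elim: j => [|j IHj]; rewrite ?mul1r // exprS -mulrA IHj.
  rewrite -(ex k) /e -exprM mulnC exprM -natrX -(prednK n_gt0) exprSr -mulrA.
  by rewrite mulr_natl x2k mulr0.
(* A corner must be a nonzero ring; when [e = 0], [fU] says that 1 is the only unit. *)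
have [e0|e_neq0] := eqVneq e 0.
  apply/centsP=> u _ v _; apply: val_inj; rewrite !FinRing.val_unitM.
  by rewrite -[val u]mul1r -[val v]mul1r -[1]subr0 -e0 !fU.
have corC : forall x y, e * x * (e * y) = e * y * (e * x).
  apply: (commutative_corner (ce := ce) (e_neq0 := e_neq0)).
  apply: reduced_finRing_commutative => u uu0.
  exact/val_inj/red/(congr1 val uu0)/corner_mulid.
apply/centsP=> u _ v _; apply: val_inj; rewrite !FinRing.val_unitM.
have eM (x y : R) : e * x * (e * y) = e * (x * y).
  by rewrite -mulrA (mulrA x) -(ec x) -mulrA mulrA ee.
(* Both products are split into components: those in [(1 - e) R] are [1 - e] by [fU], those in [e R]
   agree by [corC]. *)
rewrite -[LHS](subrK (e * (val u * val v))) -{1}[X in X - _]mul1r -mulrBl.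
rewrite -[RHS](subrK (e * (val v * val u))) -{1}[X in _ = X - _ + _]mul1r -mulrBl.
by rewrite -!eM corC !mulrA !fU.
Qed.

(** * Self-centralizing units when 2 is nilpotent *)

Lemma cyclic_involution_unique (gT : finGroupType) (G : {group gT}) (u v : gT) :
  cyclic G -> u \in G -> v \in G -> #[u]%g = 2 -> #[v]%g = 2 -> u = v.
Proof.
move=> cycG Gu Gv u2 v2.
have /eqP eq_uv : <[u]>%g == <[v]>%g :> {set gT}.
  by rewrite (eq_subG_cyclic cycG) ?cycle_subG // -!orderE u2 v2.
have := cycle_id u; rewrite eq_uv cycle2g // !inE => /orP[]/eqP // u1.
by rewrite u1 order1 in u2.
Qed.

(** Such roots are involutions centralizing [a], so they lie in the cyclic group generated by [a],
    which has at most one involution. *)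
Lemma self_centralizing_sqrt1_unique (R : finUnitRingType) (a : {unit R})
    (y z : R) :
    'C[a]%g = <[a]>%g -> GRing.comm y (val a) -> GRing.comm z (val a) ->
    y * y = 1 -> z * z = 1 -> y != 1 -> z != 1 ->
  y = z.
Proof.
move=> Ca ya za yy zz y1 z1.
have Uy : y \is a GRing.unit by apply/unitrP; exists y.
have Uz : z \is a GRing.unit by apply/unitrP; exists z.
have inC (w : R) (Uw : w \is a GRing.unit) :
    GRing.comm w (val a) -> FinRing.Unit Uw \in <[a]>%g.
  by move=> wa; rewrite -Ca; apply/cent1P/val_inj.
have ord2 (w : R) (Uw : w \is a GRing.unit) :
    w * w = 1 -> w != 1 -> #[FinRing.Unit Uw]%g = 2.
  move=> ww w1; apply/prime_nt_dvdP => //; first by rewrite order_eq1 -val_eqE.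
  by rewrite order_dvdn -val_eqE FinRing.val_unitX /= expr2 ww.
have := cyclic_involution_unique (cycle_cyclic a) (inC _ Uy ya) (inC _ Uz za)
  (ord2 _ Uy yy y1) (ord2 _ Uz zz z1).
by move/(congr1 val).
Qed.

Lemma two_nilpotent_self_centralizing (R : finUnitRingType) (a : {unit R}) m k :
    (2 ^+ m = 0 :> R) -> #[a]%g = (2 ^ k)%N -> 'C[a]%g = <[a]>%g ->
  (#[a]%g < 8)%N.
Proof.
move=> nil2 oa Ca; rewrite ltnNge; apply/negP=> oa8.
pose x := val a - 1; have defa : val a = 1 + x by rewrite addrC subrK.
have sqrt1_uniq y z : GRing.comm y x -> GRing.comm z x ->
    y * y = 1 -> z * z = 1 -> y != 1 -> z != 1 -> y = z.
  move=> yx zx; apply: (self_centralizing_sqrt1_unique Ca); rewrite defa.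
    exact/commrD/yx/commr1.
  exact/commrD/zx/commr1.
have sqr1D t : t + t = 0 -> t * t = 0 -> (1 + t) * (1 + t) = 1 :> R.
  by move=> t2 tt; rewrite mulrDl mul1r mulrDr mulr1 tt addr0 -addrA t2 addr0.
have neq1D t : t != 0 -> 1 + t != 1 :> R.
  by move=> t_neq0; rewrite -subr_eq0 addrAC subrr add0r.
have commN1 : GRing.comm (-1) x by apply/commr_sym/commrN/commr1.
have sqrN1 : -1 * -1 = 1 :> R by rewrite mulrNN mulr1.
have N1_neq1 : (2 : R) != 0 -> -1 != 1 :> R.
  by move=> two_neq0; rewrite eq_sym -subr_eq0 opprK.
(* Compare -1 with 1 + 2^j, where 2^j is the last nonzero power of 2. *)
have four0 : (4%:R = 0 :> R).
  have [two0|two_neq0] := eqVneq (2 : R) 0.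
    by rewrite (natrM R 2 2) two0 mul0r.
  have nil2' : exists j, (2 : R) ^+ j == 0 by exists m; rewrite nil2.
  case: (ex_minnP nil2') => -[|j] /eqP j0 minj.
    by move/eqP: j0; rewrite expr0 oner_eq0.
  pose t : R := 2 ^+ j.
  have t_neq0 : t != 0.
    by apply: contraTneq (ltnSn j) => t0; rewrite -leqNgt minj // -/t t0.
  have t2 : t + t = 0 by rewrite -mulr2n -mulr_natl -exprS.
  have j_gt0 : (0 < j)%N.
    by case: (j) j0 => // /eqP; rewrite expr1 (negPf two_neq0).
  have tt : t * t = 0.
    by rewrite -exprD -(prednK j_gt0) addSnnS prednK // exprD j0 mulr0.
  have tN2 : 1 + t = -1.
    apply: sqrt1_uniq; rewrite ?N1_neq1 ?neq1D ?sqr1D //.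
    by apply/commr_sym/commrD; [exact: commr1 | rewrite /t -natrX; exact: commr_nat].
  (* Now [t + t = 0] reads [- 4 = 0]. *)
  have {tN2} : t = - 2 by rewrite -[LHS](addKr 1) tN2 -opprD.
  by move/eqP: t2 => /[swap] ->; rewrite -opprD oppr_eq0 -natrD => /eqP.
(* 1 + 2x = -1 would give 2a = 0, hence 2 = 0. *)
have x2 : x + x = 0.
  have [two0|two_neq0] := eqVneq (2 : R) 0.
    by rewrite -mulr2n -mulr_natl two0 mul0r.
  apply/eqP/negPn/negP => t_neq0; case/eqP: (two_neq0).
  have : 1 + (x + x) = -1.
    apply: sqrt1_uniq; rewrite ?N1_neq1 ?neq1D ?sqr1D //.
    - by apply/commr_sym/commrD; [exact: commr1 | exact: commrD].
    - by rewrite -!mulr2n -mulrnA -mulr_natl four0 mul0r.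
    - by rewrite -!mulr2n mulrnAl mulrnAr -mulrnA -mulr_natl four0 mul0r.
  move/eqP; rewrite -subr_eq0 opprK addrAC -[1 + 1]/(2%:R) -mulr2n.
  rewrite -[x *+ 2]mulr_natl -{1}[2%:R]mulr1 -mulrDr -defa => /eqP a0.
  by apply: (mulIr (valP a)); rewrite a0 mul0r.
(* Since [x + x = 0], the cross term of each squaring vanishes, as in characteristic 2. *)
have aX i : val a ^+ (2 ^ i) = 1 + x ^+ (2 ^ i).
  elim: i => [|i IHi]; first exact: defa.
  rewrite expnSr !exprM IHi !expr2 mulrDl mul1r mulrDr mulr1 -addrA (addrA (_ ^+ _)).
  have -> : x ^+ (2 ^ i) + x ^+ (2 ^ i) = 0; last by rewrite add0r.
  by rewrite -(prednK (expn_gt0 2 i)) exprS -mulrDl x2 mul0r.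
have nilx : exists j, x ^+ j == 0.
  exists (2 ^ k)%N; rewrite -[X in X == _](addKr 1) -aX -oa -FinRing.val_unitX.
  by rewrite expg_order addNr.
case: (ex_minnP nilx) => n /eqP xn0 minn.
have x_ge j : (n <= j)%N -> x ^+ j = 0.
  by move/subnK <-; rewrite exprD xn0 mulr0.
(* Otherwise [x ^+ 4 = 0], so [a ^+ 4 = 1] by [aX], against the order of [a] being at least 8. *)
have n_gt4 : (4 < n)%N.
  rewrite ltnNge; apply: contraL oa8 => /x_ge x4; rewrite -ltnNge.
  apply: (@leq_ltn_trans 4) => //; apply: dvdn_leq => //.
  by rewrite order_dvdn -val_eqE FinRing.val_unitX (aX 2) x4 addr0.
have inv1 j : (n <= j + j)%N -> (j < n)%N ->
    [/\ GRing.comm (1 + x ^+ j) x, (1 + x ^+ j) * (1 + x ^+ j) = 1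
       & 1 + x ^+ j != 1].
  move=> le_n lt_n; split.
  - apply/commr_sym/commrD; [exact: commr1 | exact/commrX].
  - apply: sqr1D; last by rewrite -exprD x_ge.
    case: j le_n lt_n => [|j] le_n _; first by case: (n) n_gt4 le_n.
    by rewrite exprS -mulrDl x2 mul0r.
  by apply: neq1D; apply: contraL lt_n => /minn; rewrite -leqNgt.
case: n n_gt4 xn0 minn x_ge inv1 => [|[|[|[|n]]]] // _ xn0 minn x_ge inv1.
have [||c1 s1 d1] := inv1 n.+3 => //; first by rewrite addSnnS leq_addl.
have [||c2 s2 d2] := inv1 n.+2 => //.
  by rewrite addSnnS addSnnS leq_addl.
(* The nilpotency index is now [n.+4]. Multiplying [x ^+ n.+3 = x ^+ n.+2] by [x] gives
   [0 = x ^+ n.+3], against minimality. *)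
have /addrI/(congr1 ( *%R x)) := sqrt1_uniq _ _ c1 c2 s1 s2 d1 d2.
by rewrite -!exprS xn0 => /esym/eqP/minn; rewrite ltnn.
Qed.

(** The unit with component -1 in [e R] and 1 in [(1 - e) R] must be 1, so [e + e = 0]; then
    [e = e * e] is a multiple of [e + e], as [e] is a positive power of 2. *)
Lemma two_expr_eq0 (R : finUnitRingType) (n : nat) :
    (0 < n)%N -> central_idempotent (2 ^+ n : R) ->
    unit_fixing (1 - 2 ^+ n : R) = 1%g ->
  2 ^+ n = 0 :> R.
Proof.
set e := 2 ^+ n => n_gt0 ce H1; have [ee ec] := ce.
have [f1 _] := central_idempotent_compl ce.
have N1unit : (-1 : R) \is a GRing.unit by rewrite unitrN1.
pose u := FinRing.Unit (peirce_unit ce (FinRing.Unit N1unit)).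
have : u \in unit_fixing (1 - e).
  by apply/unit_fixingP; rewrite /= mulrDr f1 mulrA mulrBl mul1r ee subrr
    mul0r add0r.
rewrite H1 => /set1P/(congr1 val) /= /eqP.
rewrite mulrN1 addrCA -subr_eq0 addrAC subrr add0r -opprD oppr_eq0 => /eqP e2.
by rewrite -ee {1}/e -(prednK n_gt0) exprSr -mulrA mulr_natl [e *+ 2]mulr2n e2 mulr0.
Qed.

(* Transfer from the unit group to [G] *)
Local Close Scope ring_scope.
Local Open Scope group_scope.

Theorem mainTheorem5 (gT : finGroupType) (G : {group gT})
    (G_2group : 2.-group G) (G_indec : indecomposable G)
    (G_nonabelian : ~~ abelian G)
    (a : gT) (aG : a \in G) (a_order : 8 <= #[a]) (a_cent : 'C_G[a] = <[a]>) :
  ~ finite_ring_realizable G.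
Proof.
case=> R isoUG; have [f injf imf] := isogP (isog_symr isoUG).
have U_indec : indecomposable [set: {unit R}].
  case=> hT [kT [H [K [H1 K1 isoU]]]]; apply: G_indec; exists hT, kT, H, K.
  by split=> //; apply: isog_trans isoU; rewrite isog_sym.
have U_2group : 2.-group [set: {unit R}] by rewrite /pgroup (card_isog isoUG).
have fa_cent : 'C[f a] = <[f a]>.
  by rewrite -morphim_cycle // -a_cent injm_subcent1 // imf setTI.
have fa_order : #[f a] = #[a] by rewrite order_injm.
have [n n_gt0 ee] := exists_idempotent_expr (2%:R : R)%R.
have ce : central_idempotent (2%:R ^+ n : R)%R.
  by split=> // x; rewrite -natrX commr_nat.
(* If the factor supported on the corner of [2 ^+ n] is trivial, 2 is nilpotent and [f a] has order
   below 8; if the other factor is trivial, the unit group is abelian. *)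
have [/(two_expr_eq0 n_gt0 ce) nil2 | ] :=
    indecomposable_dprod U_indec (unit_dprod ce).
  have [k oa] := p_natP (mem_p_elt U_2group (in_setT (f a))).
  have := two_nilpotent_self_centralizing nil2 oa fa_cent.
  by rewrite fa_order ltnNge a_order.
move/(abelian_units_two_invertible U_2group n_gt0 ce).
by rewrite (isog_abelian isoUG) (negPf G_nonabelian).
Qed.
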